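(* Let $P$ be the 3-ear and let $K,K'$ be proper pseudohexes such that $K$ is obtained from $K'$ by $P$-addition. (1) If $K$ has neither a $P$-obstacle nor a $P$-danger, then $P_K$ can be safely reduced. (2) If $K$ has a $P$-danger but not a $P$-bad, let $e$ be the $P$-no-edge with both endpoints in $V(h_x)\cup V(h_y)$ and let $g$ be the $P$-no-edge which has exactly one endpoint in $V(P_K)$, this endpoint lying in $V(h_z)$. Then there is a reduction of $P_K$ that creates no end, such that every contracted path but one contains at most one derived white edge of $K$, and the remaining contracted path contains exactly two derived white edges, namely $e$ and $g$.
   Context: Pseudohex. A pseudohex is a bipartite graph $K$ (parallel edges allowed, no loops) whose edges are coloured blue, red and white, which is either empty or satisfies: (i) the blue edges form vertex-disjoint 6-cycles covering $V(K)$, called the hexagons of $K$; if a hexagon is the 6-cycle $v_0v_1\cdots v_5v_0$ we write $\bar{v_i}=v_{i+3}$ (indices mod 6); (ii) for each vertex $x$, $\{x,\bar x\}$ is a red edge of $K$ (further red edges may exist); (iii) the white edges form a perfect matching of $K$. A white edge $e=\{x,y\}$ is real if $\bar e=\{\bar x,\bar y\}$ is also a white edge and the only red edges sharing a vertex with $e$ or $\bar e$ are $\{x,\bar x\}$ and $\{y,\bar y\}$; non-real white edges are derived. Two white edges are red-connected if some red edge is adjacent to both. An end is a red edge parallel to a white edge; $K$ has an end if it contains one. $G^K$ is the graph whose vertices are the hexagons of $K$, two hexagons being adjacent iff some pair of real white edges $e,\bar e$ joins them. $K$ is proper if it has no end and $G^K$ is 2-connected with no cycle of length 2. Reduction. Let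 $h$ be a hexagon and $N$ one of the two perfect matchings of its blue 6-cycle. For each edge of $N$, let $Q$ be the path formed by that edge and the two white edges adjacent to it. If $Q$ is not a cycle of length 2, add a new white edge $e_Q$ joining the end vertices of $Q$, and for each red edge $\{u,w\}$ with $w$ an interior vertex of $Q$ add a red edge $\{u,w'\}$ where $w'$ is the endpoint of $e_Q$ in the same bipartition class as $w$. If $Q$ is a cycle of length 2, then for each red edge $\{u,w\}$ with $w$ an interior vertex of $Q$ add a red edge $\{u,\bar u\}$. Finally delete the vertices of $h$. Reducing hexagons $h_1,\dots,h_l$ by perfect matchings $N_1,\dots,N_l$ means performing these reductions successively; its contracted paths are the components (paths and cycles) of the subgraph of $K$ formed by $N_1\cup\dots\cup N_l$ together with all white edges having an endpoint in $V(h_1)\cup\dots\cup V(h_l)$. The reduction is safe if every contracted path/cycle contains at most one derived white edge of $K$; a set of hexagons can be safely reduced if some choice of perfect matchings gives a safe reduction. The reduction creates an end if the resulting pseudohex has an end. 3-ear and addition. The 3-ear $P$ is the path $x z y$ (leaves $x,y$, centre $z$); the bold 3-ear has one half-edge at each of $x,y$. A graph is obtained from $G'$ by addition of the bold 3-ear if it is obtained from the disjoint union of $G'$ and $P$ by joining the two half-edges to two distinct vertices of degree 2 of $G'$. $K$ is obtained from $K'$ by $P$-addition if $G^K$ is obtained from $G^{K'}$ by addition of the bold 3-ear; $P_K=\{h_x,h_y,h_z\}$ is the set of hexagons of $K$ corresponding to $x,y,z$, and $V(P_K)$ the set of their vertices. $P$-no-edges are the derived white edges of $K$ with at least one endpoint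 in $V(P_K)$. $K$ has a $P$-obstacle if every $P$-no-edge has exactly one endpoint in $V(P_K)$. $K$ has a $P$-danger if: one $P$-no-edge has both endpoints in $V(h_x)\cup V(h_y)$; one $P$-no-edge has one endpoint in $V(h_x)\cup V(h_y)$ and the other in $V(h_z)$; and the remaining two $P$-no-edges each have exactly one endpoint in $V(P_K)$. $K$ has a $P$-bad if it has a $P$-danger and the $P$-no-edge with both endpoints in $V(h_x)\cup V(h_y)$ is red-connected to the $P$-no-edge that has exactly one endpoint in $V(P_K)$ with that endpoint in $V(h_z)$. *)

(* Defs.v *)
From HB Require Import structures.
From mathcomp Require Import all_boot.
Set Implicit Arguments. Unset Strict Implicit. Unset Printing Implicit Defensive.

(* The hexagons form a finite type H; the vertex set is H * 'I_6, the        *)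
(* hexagon h being the blue 6-cycle (h,0)(h,1)...(h,5)(h,0).  The blue edges *)
(* are therefore implicit.  The bipartition class of (h,i) is odd i.          *)
(* White edges (a perfect matching) are given by the matching involution wh; *)
(* red edges are given by a symmetric relation red (multiplicities of red    *)
(* edges play no role in any notion used below).                             *)

Notation hv H := (H * 'I_6)%type.

Definition add6 (i : 'I_6) (k : nat) : 'I_6 := inord ((i + k) %% 6).

Definition bar (H : finType) (x : hv H) : hv H := (x.1, add6 x.2 3).

Definition side (H : finType) (x : hv H) : bool := odd x.2.

Record pseudohex (H : finType) := Pseudohex {
  wh : hv H -> hv H;
  red : rel (hv H)
}.

Definition is_pseudohex (H : finType) (K : pseudohex H) : Prop :=
  (forall x, wh K (wh K x) = x) /\
  (forall x, side (wh K x) != side x) /\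
  (forall x y, red K x y = red K y x) /\
  (forall x y, red K x y -> side x != side y) /\
  (forall x, red K x (bar x)).

Definition wedge (H : finType) (K : pseudohex H) (x : hv H) : {set hv H} :=
  [set x; wh K x].

Definition real (H : finType) (K : pseudohex H) (x : hv H) : bool :=
  (wh K (bar x) == bar (wh K x)) &&
  [forall v in [set x; wh K x; bar x; bar (wh K x)],
     forall u, red K v u ==> (u == bar v)].

Definition derived (H : finType) (K : pseudohex H) (x : hv H) : bool :=
  ~~ real K x.

Definition red_connected (H : finType) (K : pseudohex H) (e1 e2 : {set hv H}) : Prop :=
  exists u v, red K u v /\ (u \in e1 \/ v \in e1) /\ (u \in e2 \/ v \in e2).

Definition has_end (H : finType) (K : pseudohex H) : bool :=
  [exists x, red K x (wh K x)].

(* Finite multigraphs (loops allowed: an edge with a 1-element end set).     *)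

Record mgraph := MGraph {
  mV : finType;
  mE : finType;
  mends : mE -> {set mV}
}.

Definition mdeg (G : mgraph) (v : mV G) : nat :=
  \sum_(e : mE G) (if mends e == [set v] then 2 else (v \in mends e : nat)).

Definition madj (G : mgraph) (X : {set mV G}) : rel (mV G) :=
  fun u v => (u \notin X) && (v \notin X) &&
             [exists e : mE G, (u \in mends e) && (v \in mends e)].

Definition connected_minus (G : mgraph) (X : {set mV G}) : Prop :=
  forall u v, u \notin X -> v \notin X -> connect (madj X) u v.

Definition two_connected (G : mgraph) : Prop :=
  3 <= #|mV G| /\ connected_minus (set0 : {set mV G}) /\
  forall v : mV G, connected_minus [set v].

Definition no_2cycle (G : mgraph) : Prop :=
  forall e1 e2 : mE G, e1 != e2 -> #|mends e1| = 2 -> mends e1 <> mends e2.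

Definition mgraph_iso (G1 G2 : mgraph) (fV : mV G1 -> mV G2) (fE : mE G1 -> mE G2)
  : Prop :=
  bijective fV /\ bijective fE /\ forall e, mends (fE e) = fV @: mends e.

Definition isGE (H : finType) (K : pseudohex H) (E : {set {set hv H}}) : bool :=
  [exists x, real K x && (E == [set wedge K x; wedge K (bar x)])].

Definition GE (H : finType) (K : pseudohex H) := {E : {set {set hv H}} | isGE K E}.

Definition GK_ends (H : finType) (K : pseudohex H) (E : GE K) : {set H} :=
  [set h | [exists x : hv H, (wedge K x \in val E) && (x.1 == h)]].

Definition GK (H : finType) (K : pseudohex H) : mgraph :=
  @MGraph H (GE K) (@GK_ends H K).

Definition proper_pseudohex (H : finType) (K : pseudohex H) : Prop :=
  is_pseudohex K /\ ~~ has_end K /\ two_connected (GK K) /\ no_2cycle (GK K).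

Definition ear_x : 'I_3 := inord 0.
Definition ear_z : 'I_3 := inord 1.
Definition ear_y : 'I_3 := inord 2.

Definition add3_ends (G : mgraph) (u v : mV G) (e : (mE G + 'I_4)%type)
  : {set (mV G + 'I_3)%type} :=
  match e with
  | inl e' => inl @: mends e'
  | inr k => match val k with
             | 0 => [set inr ear_x; inr ear_z]
             | 1 => [set inr ear_z; inr ear_y]
             | 2 => [set inr ear_x; inl u]
             | _ => [set inr ear_y; inl v]
             end
  end.

Definition add_bold_3ear (G : mgraph) (u v : mV G) : mgraph :=
  @MGraph (mV G + 'I_3)%type (mE G + 'I_4)%type (add3_ends u v).

Definition P_addition (H H' : finType) (K : pseudohex H) (K' : pseudohex H')
  (u v : mV (GK K'))
  (fV : mV (add_bold_3ear u v) -> mV (GK K))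
  (fE : mE (add_bold_3ear u v) -> mE (GK K)) : Prop :=
  u != v /\ mdeg u = 2 /\ mdeg v = 2 /\ mgraph_iso fV fE.

Definition Vset (H : finType) (A : {set H}) : {set hv H} := [set x | x.1 \in A].

Definition no_edges (H : finType) (K : pseudohex H) (A : {set H}) : {set {set hv H}} :=
  [set e | [exists x, (e == wedge K x) && derived K x && (x.1 \in A)]].

Definition P_obstacle (H : finType) (K : pseudohex H) (hx hy hz : H) : Prop :=
  forall e, e \in no_edges K [set hx; hy; hz] ->
    #|e :&: Vset [set hx; hy; hz]| = 1.

Definition P_danger (H : finType) (K : pseudohex H) (hx hy hz : H) : Prop :=
  exists e1 e2 e3 e4 : {set hv H},
    uniq [:: e1; e2; e3; e4] /\
    no_edges K [set hx; hy; hz] = [set e1; e2; e3; e4] /\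
    e1 \subset Vset [set hx; hy] /\
    #|e2 :&: Vset [set hx; hy]| = 1 /\ #|e2 :&: Vset [set hz]| = 1 /\
    #|e3 :&: Vset [set hx; hy; hz]| = 1 /\
    #|e4 :&: Vset [set hx; hy; hz]| = 1.

Definition P_bad (H : finType) (K : pseudohex H) (hx hy hz : H) : Prop :=
  P_danger K hx hy hz /\
  exists e g : {set hv H},
    e \in no_edges K [set hx; hy; hz] /\ e \subset Vset [set hx; hy] /\
    g \in no_edges K [set hx; hy; hz] /\
    #|g :&: Vset [set hx; hy; hz]| = 1 /\
    g :&: Vset [set hz] != set0 /\ red_connected K e g.

(* Reductions.  A choice of perfect matchings is b : H -> bool; b h = false  *)
(* selects N = {v0v1, v2v3, v4v5}, b h = true selects {v1v2, v3v4, v5v0}.    *)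

Definition Nedges (H : finType) (h : H) (b : bool) : seq (hv H * hv H) :=
  if b then [:: ((h, inord 1), (h, inord 2)); ((h, inord 3), (h, inord 4));
                ((h, inord 5), (h, inord 0))]
  else [:: ((h, inord 0), (h, inord 1)); ((h, inord 2), (h, inord 3));
           ((h, inord 4), (h, inord 5))].

Definition Nadj (H : finType) (A : {set H}) (b : H -> bool) : rel (hv H) :=
  fun x y => (x.1 \in A) &&
    (((x, y) \in Nedges x.1 (b x.1)) || ((y, x) \in Nedges x.1 (b x.1))).

Definition cadj (H : finType) (K : pseudohex H) (A : {set H}) (b : H -> bool)
  : rel (hv H) :=
  fun x y => Nadj A b x y ||
             ((y == wh K x) && ((x \in Vset A) || (y \in Vset A))).

(* derived white edges of K lying in the contracted path/cycle containing r *)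
Definition comp_derived (H : finType) (K : pseudohex H) (A : {set H}) (b : H -> bool)
  (r : hv H) : {set {set hv H}} :=
  [set e | [exists x, (e == wedge K x) &&
                      ((x \in Vset A) || (wh K x \in Vset A)) &&
                      derived K x && connect (cadj K A b) r x]].

Definition safe_reduction (H : finType) (K : pseudohex H) (A : {set H}) (b : H -> bool)
  : Prop := forall r, #|comp_derived K A b r| <= 1.

Definition safely_reducible (H : finType) (K : pseudohex H) (A : {set H}) : Prop :=
  exists b : H -> bool, safe_reduction K A b.

(* The reduction process itself: state = alive vertices, white matching,   *)
(* red relation.  One step treats one edge {a,b} of N (path Q).            *)
Record rstate (H : finType) := RState {
  st_alive : pred (hv H);
  st_w : hv H -> hv H;
  st_red : rel (hv H)
}.

Definition qstep (H : finType) (S : rstate H) (ab : hv H * hv H) : rstate H :=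
  let a := ab.1 in let b := ab.2 in
  let w := st_w S in let r := st_red S in
  let alive' := fun v => st_alive S v && (v != a) && (v != b) in
  if w a == b then
    (* Q is a cycle of length 2: add {u, u bar} for red {u, w0}, w0 interior *)
    @RState H alive' w
      (fun u v => r u v ||
         [exists u0, [exists w0, r u0 w0 && ((w0 == a) || (w0 == b)) &&
            (((u == u0) && (v == bar u0)) || ((v == u0) && (u == bar u0)))]])
  else
    let p := w a in let q := w b in
    let prim := fun x => if side p == side x then p else q in
    @RState H alive'
      (fun x => if x == p then q else if x == q then p else w x)
      (fun u v => r u v ||
         [exists u0, [exists w0, r u0 w0 && ((w0 == a) || (w0 == b)) &&
            (((u == u0) && (v == prim w0)) || ((v == u0) && (u == prim w0)))]]).

Definition reduce (H : finType) (K : pseudohex H) (sched : seq (hv H * hv H))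
  : rstate H :=
  foldl (@qstep H) (@RState H predT (wh K) (red K)) sched.

Definition creates_end (H : finType) (K : pseudohex H) (sched : seq (hv H * hv H))
  : bool :=
  let R := reduce K sched in
  [exists x, st_alive R x && st_alive R (st_w R x) && st_red R x (st_w R x)].

(* Main.v *)
Require Import Defs.
From HB Require Import structures.
From mathcomp Require Import all_boot.
Set Implicit Arguments. Unset Strict Implicit. Unset Printing Implicit Defensive.

(* Each hexagon of the ear carries two antipodal pairs of real edges and one    *)
(* antipodal pair of ends of derived edges.  As a hexagon is K_{3,3} between    *)
(* its sides minus the antipodal matching, a perfect matching of it amounts to  *)
(* a cyclic rotation of the three pairs.  So everything depends on which of the *)
(* six derived ends of the ear are matched to one another: this leaves          *)
(* finitely many patterns, each with 8 reductions, and a labelling of the 18    *)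
(* vertices by contracted path separates the derived edges.  For the absence of *)
(* ends, it suffices that no red edge of K has both ends on the same contracted *)
(* path, because this property persists through the reduction.                  *)

(** Let k be the number of derived edges with both ends in the ear. Then 6 - k derived edges meet
    the ear, and (6 - 2k) + 4 white edges leave it, the last four being real edges at the leaves; so
    there are 5 - k contracted paths. A safe reduction must therefore put some derived edge on a
    contracted cycle. Under an obstacle k = 0 and this is impossible; otherwise an inner derived
    edge can be closed up through real edges of the ear. In a danger the reduction sought instead
    links e to g through a real edge between a leaf and the centre, and keeps antipodal vertices of
    real edges on different contracted paths. A red edge with both ends on one contracted path would
    then have to join e to g, which makes the danger a P-bad.

    The existence claims about patterns are [safe_choice_exists] and [danger_choice_exists], proved
    by evaluation. [ear_coords] identifies the ear of [K] with the finite model,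
    [choice_of_matchings] turns rotations of the model into perfect matchings, and [label_connect]
    shows that labels are constant on contracted paths. [obstacle_of_pattern], [danger_of_pattern]
    and [pattern_of_danger] translate the hypotheses; [safely_reducible_of_pattern] and
    [danger_reduction] give the two claims. *)

Definition tri : predArgType := option bool.
Notation t0 := (None : tri).
Notation t1 := (Some false : tri).
Notation t2 := (Some true : tri).

Definition next3 (t : tri) : tri :=
  match t with None => t1 | Some false => t2 | Some true => t0 end.
Definition prev3 (t : tri) : tri :=
  match t with None => t2 | Some false => t0 | Some true => t1 end.
Definition rot3 (o : bool) : tri -> tri := if o then prev3 else next3.

(* A vertex (h, k, s) of the ear: h is the hexagon (t0 = x, t1 = y, t2 = z), s   *)
(* the side, and k the antipodal pair: t0 is the pair of derived ends; for the  *)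
(* leaves, t1 is joined to z and t2 to the outside; for z, t1 is joined to x    *)
(* and t2 to y.                                                                 *)
Definition cell : predArgType := (tri * tri * bool)%type.

(* The derived edges inside the ear: the even derived end of hexagon x, y, z is *)
(* matched to the odd derived end of the given hexagon, if any.                 *)
Definition matching := (option tri * option tri * option tri)%type.

Definition mate_even (m : matching) (h : tri) : option tri :=
  match h with None => m.1.1 | Some false => m.1.2 | Some true => m.2 end.

Definition tris : seq tri := [:: t0; t1; t2].

Definition mate (m : matching) (h : tri) (s : bool) : option tri :=
  if s then ohead [seq h' <- tris | mate_even m h' == Some h] else mate_even m h.

Definition wmate (m : matching) (v : cell) : option cell :=
  match v with
  | (h, None, s) => omap (fun h' => (h', t0, ~~ s)) (mate m h s)
  | (None, Some false, s) => Some (t2, t1, ~~ s)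
  | (Some false, Some false, s) => Some (t2, t2, ~~ s)
  | (Some true, Some false, s) => Some (t0, t1, ~~ s)
  | (Some true, Some true, s) => Some (t1, t1, ~~ s)
  | (_, Some true, _) => None
  end.

(** A perfect matching of the hexagon shifts the three pairs cyclically, forwards from one side and
    backwards from the other; [sg] says which. *)
Definition nmate (sg : tri -> bool) (v : cell) : cell :=
  (v.1.1, rot3 (v.2 (+) sg v.1.1) v.1.2, ~~ v.2).

(** A derived edge between the two derived ends of one hexagon would join antipodal vertices, hence
    be parallel to a red edge: an end. *)
Definition valid (m : matching) : bool :=
  all (fun h => mate_even m h != Some h) tris &&
  all (fun h => all (fun h' => (mate_even m h == mate_even m h') &&
    (mate_even m h != None) ==> (h == h')) tris) tris.

Definition dcells : seq cell :=
  [seq (h, t0, s) | h <- tris, s <- [:: false; true]].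
Definition cells : seq cell :=
  [seq (hk, s) | hk <- [seq (h, k) | h <- tris, k <- tris], s <- [:: false; true]].

Definition same_wedge (m : matching) (v w : cell) : bool :=
  (v == w) || (wmate m v == Some w).

Definition inner_xy (m : matching) (v : cell) : bool :=
  [&& v.1.2 == t0, v.1.1 != t2 &
      if wmate m v is Some w then w.1.1 != t2 else false].
Definition outer_z (m : matching) (v : cell) : bool :=
  [&& v.1.2 == t0, v.1.1 == t2 & wmate m v == None].

Definition obstacle_pattern (m : matching) : bool :=
  all (fun v => wmate m v == None) dcells.

(** The leaf [p] sends one derived end to the other leaf and one to the centre; the sides follow,
    since white edges change side. *)
Definition danger_shape (m : matching) (p q : tri) (s : bool) : bool :=
  [&& wmate m (p, t0, s) == Some (q, t0, ~~ s),
      wmate m (p, t0, ~~ s) == Some (t2, t0, s),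
      wmate m (q, t0, s) == None & wmate m (t2, t0, ~~ s) == None].

Definition danger_pattern (m : matching) : bool :=
  [|| danger_shape m t0 t1 false, danger_shape m t0 t1 true,
      danger_shape m t1 t0 false | danger_shape m t1 t0 true].

Definition code3 (t : tri) : nat :=
  match t with None => 0 | Some false => 1 | Some true => 2 end.
Definition code (v : cell) : nat := code3 v.1.1 * 6 + code3 v.1.2 * 2 + v.2.

(* Iterating [relabel] spreads the least number over each contracted path.      *)
Definition relabel m sg (t : seq nat) : seq nat :=
  [seq minn (nth 0 t (code v)) (minn (nth 0 t (code (nmate sg v)))
     (if wmate m v is Some w then nth 0 t (code w) else nth 0 t (code v)))
  | v <- cells].

Definition compatible m sg (lab : cell -> nat) : bool :=
  all (fun v => (lab (nmate sg v) == lab v) &&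
    (if wmate m v is Some w then lab w == lab v else true)) cells.

Definition selector (abc : bool * bool * bool) (t : tri) : bool :=
  match t with None => abc.1.1 | Some false => abc.1.2 | Some true => abc.2 end.
Definition selectors : seq (bool * bool * bool) :=
  [seq (ab, c) | ab <- [seq (a, b) | a <- [:: false; true], b <- [:: false; true]],
                 c <- [:: false; true]].

(** No property of the iteration has to be proved: [compatible] is checked afterwards on the table
    it returns. *)
Definition table m sg : cell -> nat :=
  let t := iter 18 (relabel m sg) (iota 0 18) in fun v => nth 0 t (code v).

Definition safe_choice m sg (lab : cell -> nat) : bool :=
  compatible m sg lab &&
  all (fun v => all (fun w => (lab v == lab w) ==> same_wedge m v w) dcells)
      dcells.

(** The second clause lets only e and g share a label. Real edges meet only antipodal red edges, and
    the third clause separates the ends of those. The last clause exhibits a walk from e to g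
    through one real edge between a leaf and the centre. *)
Definition danger_choice m sg (lab : cell -> nat) : bool :=
  [&& compatible m sg lab,
   all (fun v => all (fun w => (lab v == lab w) ==>
     [|| same_wedge m v w, inner_xy m v && outer_z m w
       | inner_xy m w && outer_z m v]) dcells) dcells,
   all (fun v => (v.1.2 != t0) ==> (lab (v.1, ~~ v.2) != lab v)) cells &
   has (fun v => inner_xy m v &&
     if wmate m (nmate sg v) is Some w then outer_z m (nmate sg w) else false)
     dcells].

Lemma safe_choice_exists m :
  [&& valid m, ~~ obstacle_pattern m & ~~ danger_pattern m] ==>
  has (fun c => safe_choice m (selector c) (table m (selector c))) selectors.
Proof. by case: m => [[[[[]|]|] [[[]|]|]] [[[]|]|]]; vm_compute. Qed.

Lemma danger_choice_exists m :
  valid m && danger_pattern m ==>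
  has (fun c => danger_choice m (selector c) (table m (selector c))) selectors.
Proof. by case: m => [[[[[]|]|] [[[]|]|]] [[[]|]|]]; vm_compute. Qed.

Lemma danger_unique m : valid m && danger_pattern m ==>
  all (fun v => all (fun w => (inner_xy m v && inner_xy m w) ||
    (outer_z m v && outer_z m w) ==> same_wedge m v w) dcells) dcells.
Proof. by case: m => [[[[[]|]|] [[[]|]|]] [[[]|]|]]; vm_compute. Qed.

(** If (p, s) is matched to (q, ~~ s) for the two leaves p and q, parity leaves only two possible
    edges to the centre: from (p, ~~ s) to (t2, s) and from (q, s) to (t2, ~~ s). One is present,
    and not both since some derived end leaves the ear; either one alone is a danger shape. *)
Lemma danger_patternP m :
  [&& valid m, has (inner_xy m) dcells,
      has (fun v => (v.1.1 == t2) && (wmate m v != None)) dcells &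
      has (fun v => wmate m v == None) dcells] ==> danger_pattern m.
Proof. by case: m => [[[[[]|]|] [[[]|]|]] [[[]|]|]]; vm_compute. Qed.

Lemma mem_cells v : v \in cells.
Proof. by case: v => [[[[]|] [[]|]] []]. Qed.

Lemma mem_dcells h s : (h, t0, s) \in dcells.
Proof. by case: h => [[]|]; case: s. Qed.

(** * Coordinates in a hexagon: antipodal pair and side *)

Definition cls (i : 'I_6) : tri :=
  match i %% 3 with 0 => t0 | 1 => t1 | _ => t2 end.

(* Chinese remaindering: [hex_vertex c s] is the i < 6 with i = c mod 3 and odd i = s. *)
Definition hex_vertex (c : tri) (s : bool) : 'I_6 :=
  match c, s with
  | None, false => @Ordinal 6 0 isT | None, true => @Ordinal 6 3 isT
  | Some false, false => @Ordinal 6 4 isT | Some false, true => @Ordinal 6 1 isT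
  | Some true, false => @Ordinal 6 2 isT | Some true, true => @Ordinal 6 5 isT
  end.

Lemma cls_hex_vertex c s : cls (hex_vertex c s) = c.
Proof. by case: c => [[]|]; case: s. Qed.

Lemma odd_hex_vertex c s : odd (hex_vertex c s) = s.
Proof. by case: c => [[]|]; case: s. Qed.

Lemma hex_vertexK i : hex_vertex (cls i) (odd i) = i.
Proof. by apply: val_inj; case: i => [[|[|[|[|[|[|]]]]]]]. Qed.

Lemma add6_hex_vertex c s : add6 (hex_vertex c s) 3 = hex_vertex c (~~ s).
Proof. by apply: val_inj; rewrite /add6 /= inordK; case: c => [[]|]; case: s. Qed.

Lemma inord6 : (inord 0 = hex_vertex t0 false) * (inord 1 = hex_vertex t1 true) *
  (inord 2 = hex_vertex t2 false) * (inord 3 = hex_vertex t0 true) *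
  (inord 4 = hex_vertex t1 false) * (inord 5 = hex_vertex t2 true).
Proof. by do !split; apply: val_inj; rewrite /= inordK. Qed.

(** A step along the 6-cycle changes the residue mod 3 by one, and each of the two perfect matchings
    steps forwards from one side and backwards from the other. *)
Lemma Nadj_hex_vertex (H : finType) (A : {set H}) (b : H -> bool) h c s y :
  h \in A -> Nadj A b (h, hex_vertex c s) y =
  (y == (h, hex_vertex (rot3 (s (+) b h) c) (~~ s))).
Proof.
move=> hA; rewrite /Nadj /= hA /= /Nedges.
case: y => h' j; rewrite -{}[j]hex_vertexK; move: (cls j) (odd j) => {}j s'.
by case: (b h); rewrite !inE !xpair_eqE /= !inord6 eqxx /= [h' == h]eq_sym;
   case: (h == h'); case: c => [[]|]; case: s; case: j => [[]|]; case: s'.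
Qed.

(** A permutation of three points either commutes with the 3-cycle or inverts it. *)
Lemma inj_tri_rot (f : tri -> tri) : injective f ->
  exists o : bool, forall e k, f (rot3 e k) = rot3 (e (+) o) (f k).
Proof.
move=> fI.
have n01: f t0 <> f t1 by move/fI.
have n02: f t0 <> f t2 by move/fI.
have n12: f t1 <> f t2 by move/fI.
(* This is true exactly when [f] reverses the cyclic order. *)
exists (f t1 == prev3 (f t0)).
by case E0: (f t0) n01 n02 => [[]|]; case E1: (f t1) n12 => [[]|];
   case E2: (f t2) => [[]|] // _ _ _ [] [[]|]; rewrite /= ?E0 ?E1 ?E2.
Qed.

Lemma mate_odd m h t :
  valid m ==> ((mate m h true == Some t) == (mate_even m t == Some h)).
Proof.
by case: h => [[]|]; case: t => [[]|];
   case: m => [[[[[]|]|] [[[]|]|]] [[[]|]|]]; vm_compute.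
Qed.

Lemma validP m : (forall h, mate_even m h <> Some h) ->
  (forall h h' t, mate_even m h = Some t -> mate_even m h' = Some t -> h = h') ->
  valid m.
Proof.
move=> nfix inj; apply/andP; split; first by apply/allP => h _; apply/eqP.
apply/allP => h _; apply/allP => h' _; apply/implyP => /andP[/eqP E].
by case F: (mate_even m h) => [t|] // _; apply/eqP/(inj _ _ t) => //; rewrite -E.
Qed.

(** * White, red and real edges of a pseudohex, and the edges of its hexagon graph *)

Section Pseudohex.
Variables (H : finType) (K : pseudohex H).
Hypotheses (KP : is_pseudohex K) (noend : ~~ has_end K).
Implicit Types x y : hv H.

Lemma whK : involutive (wh K). Proof. by case: KP. Qed.

Lemma red_whF x : red K x (wh K x) = false.
Proof. by apply: contraNF noend => rx; apply/existsP; exists x. Qed.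

Lemma redC x y : red K x y = red K y x.
Proof. by case: KP => _ [_ [-> //]]. Qed.

Lemma red_bar x : red K x (bar x).
Proof. by case: KP => _ [_ [_ []]]. Qed.

Lemma red_neq x y : red K x y -> x != y.
Proof.
by case: KP => _ [_ [_ [rs _]]] /rs; apply: contraNneq => ->.
Qed.

Lemma side_wh x : odd (wh K x).2 = ~~ odd x.2.
Proof.
by case: KP => _ [/(_ x) + _]; rewrite /side; case: odd; case: odd.
Qed.

Lemma wh_neq x : wh K x != x.
Proof. by apply/eqP => /(congr1 (fun y => odd y.2)); rewrite side_wh; case: odd. Qed.

Lemma barE x : bar x = (x.1, hex_vertex (cls x.2) (~~ odd x.2)).
Proof. by rewrite /bar -{1}[x.2]hex_vertexK add6_hex_vertex. Qed.

Lemma barK : involutive (@bar H).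
Proof.
move=> x; rewrite barE barE /= cls_hex_vertex odd_hex_vertex negbK hex_vertexK.
by rewrite -surjective_pairing.
Qed.

Lemma vertex_eq x y : x.1 = y.1 -> cls x.2 = cls y.2 -> odd x.2 = odd y.2 -> x = y.
Proof.
case: x y => [h i] [h' j] /= -> ci oi.
by rewrite -[i]hex_vertexK ci oi hex_vertexK.
Qed.

Lemma same_pair x y : x.1 = y.1 -> cls x.2 = cls y.2 -> y = x \/ y = bar x.
Proof.
move=> xy1 xy2; case: (eqVneq (odd x.2) (odd y.2)) => [o|/eqP o].
  by left; apply/esym/vertex_eq.
right; rewrite barE; apply: vertex_eq => //=; first by rewrite cls_hex_vertex.
by rewrite odd_hex_vertex; case: odd o; case: odd.
Qed.

Lemma realP x : reflect (wh K (bar x) = bar (wh K x) /\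
  forall v, v \in [set x; wh K x; bar x; bar (wh K x)] ->
  forall u, red K v u -> u = bar v) (real K x).
Proof.
apply: (iffP andP) => [[/eqP -> /forall_inP h]|[-> h]]; split=> //.
  by move=> v /h /forallP vR u; move: (vR u) => /implyP hu /hu /eqP.
by apply/forall_inP => v /h vR; apply/forallP => u; apply/implyP => /vR /eqP.
Qed.

Lemma real_wh_imp x : real K x -> real K (wh K x).
Proof.
move=> /realP[ex hx]; apply/realP; rewrite whK -ex whK; split=> // v.
rewrite !inE -!orbA => vR; apply: hx; rewrite !inE -ex.
by case/or4P: vR => ->; rewrite ?orbT.
Qed.

Lemma real_bar_imp x : real K x -> real K (bar x).
Proof.
move=> /realP[ex hx]; apply/realP; rewrite ex !barK; split=> // v.
rewrite !inE -!orbA => vR; apply: hx; rewrite !inE.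
by case/or4P: vR => ->; rewrite ?orbT.
Qed.

Lemma real_wh x : real K (wh K x) = real K x.
Proof. by apply/idP/idP => /real_wh_imp; rewrite ?whK. Qed.

Lemma real_red x u : real K x -> red K x u -> u = bar x.
Proof. by move=> /realP[_ h]; apply: h; rewrite !inE eqxx. Qed.

Lemma real_wh_bar x : real K x -> wh K (bar x) = bar (wh K x).
Proof. by case/realP. Qed.

(** Real edges come in antipodal pairs, so reality and the target pair depend only on the antipodal
    pair one starts from. *)
Lemma real_same_pair x y : real K x -> x.1 = y.1 -> cls x.2 = cls y.2 ->
  [/\ real K y, (wh K y).1 = (wh K x).1 & cls (wh K y).2 = cls (wh K x).2].
Proof.
move=> rx /same_pair h /h[] -> //; rewrite real_bar_imp // real_wh_bar //.
by rewrite barE /= cls_hex_vertex.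
Qed.

Lemma wedge_wh x : wedge K (wh K x) = wedge K x.
Proof. by rewrite /wedge whK setUC. Qed.

Lemma wedge_inj x y : wedge K x = wedge K y -> x = y \/ x = wh K y.
Proof.
move=> E; have: x \in wedge K y by rewrite -E !inE eqxx.
by rewrite !inE => /orP[] /eqP; [left|right].
Qed.

Lemma card_wedgeI x (S : {set hv H}) :
  #|wedge K x :&: S| = (x \in S) + (wh K x \in S).
Proof.
rewrite -sum1_card big_mkcond (bigD1 x) //= (bigD1 (wh K x)) ?wh_neq //=.
rewrite !inE !eqxx orbT /= big1 ?addn0 => [|z /andP[zx zw]].
  by case: (x \in S); case: (wh K x \in S).
by rewrite !inE (negPf zx) (negPf zw).
Qed.

(** An edge of [GK K] is an unordered pair of white edges; this orients it by a real vertex lying in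
    the prescribed hexagon. *)
Lemma GE_repr (E : GE K) h : h \in GK_ends E ->
  exists x, [/\ real K x, val E = [set wedge K x; wedge K (bar x)], x.1 = h &
    GK_ends E = [set h; (wh K x).1]].
Proof.
have [x /andP[rx /eqP xE]] := existsP (valP E).
have endsE : GK_ends E = [set x.1; (wh K x).1].
  apply/setP => k; rewrite !inE xE; apply/existsP/orP => [[y]|].
    rewrite !inE => /andP[/orP[] /eqP /wedge_inj[] -> /eqP <-];
      rewrite ?real_wh_bar //; by [left|right].
  by case=> /eqP ->; [exists x|exists (wh K x)]; rewrite ?wedge_wh !inE !eqxx.
rewrite endsE !inE => /orP[] /eqP ->; first by exists x.
exists (wh K x); split=> //; first by rewrite real_wh.
  by rewrite -real_wh_bar // !wedge_wh.
by rewrite whK setUC.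
Qed.

Lemma GE_eq (E : GE K) x v : real K x -> val E = [set wedge K x; wedge K (bar x)] ->
  wedge K v \in val E ->
  (v.1 = x.1 /\ cls v.2 = cls x.2) \/ (v.1 = (wh K x).1 /\ cls v.2 = cls (wh K x).2).
Proof.
move=> rx ->; rewrite !inE => /orP[] /eqP /wedge_inj[] ->; try by [left|right].
  by left; rewrite barE /= cls_hex_vertex.
by right; rewrite real_wh_bar // barE /= cls_hex_vertex.
Qed.

End Pseudohex.

(** * Labellings as invariants of paths and of the reduction process *)

Lemma connect_invariant (T : finType) (S : Type) (e : rel T) (L : T -> S) x y :
  (forall u v, e u v -> L u = L v) -> connect e x y -> L x = L y.
Proof.
move=> inv /connectP[p + ->]; elim: p x => //= z p IH x /andP[/inv -> /IH //].
Qed.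

(* A red edge inside a class can only come from a red edge inside a class: the  *)
(* replaced end stays in its class, and the edges {u, bar u} are red already.   *)
Lemma no_end_created (H : finType) (K : pseudohex H) (S : Type) (L : hv H -> S) sched :
  (forall x, red K x (bar x)) -> (forall x, L (wh K x) = L x) ->
  (forall u v, red K u v -> L u <> L v) ->
  {in sched, forall ab, L ab.1 = L ab.2} -> ~~ creates_end K sched.
Proof.
move=> rbar Lwh Lred Lsched.
pose ok (R : rstate H) := [/\ forall x, st_red R x (bar x),
  forall x, L (st_w R x) = L x & forall u v, st_red R u v -> L u <> L v].
suff [_ Lw Lr] : ok (reduce K sched).
  by apply/existsP => -[x /andP[_ /Lr]]; rewrite Lw.
have : ok (@RState H predT (wh K) (red K)) by [].
rewrite /reduce; elim: sched (RState _ _ _) Lsched => //= -[a b] sched IH R Ls Rok.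
apply: IH => [ab abs|]; first by apply: Ls; rewrite inE abs orbT.
have /= Lab := Ls (a, b) (mem_head _ _).
case: Rok => rb Lw Lr; rewrite /qstep /=; case: ifP => _.
  split=> //= [x|u v]; first by rewrite rb.
  case/orP => [/Lr //|/existsP[u0 /existsP[w0 /andP[_]]]].
  case/orP => /andP[/eqP -> /eqP ->]; first exact: Lr.
  by apply/nesym/Lr.
split=> /= [x|x|u v]; first by rewrite rb.
  case: eqP => [->|_]; first by rewrite !Lw.
  by case: eqP => [->|_]; rewrite !Lw.
case/orP => [/Lr //|/existsP[u0 /existsP[w0 /andP[/andP[/Lr uw w0ab]]]]].
have Lw0 : L w0 = L a by case/orP: w0ab => /eqP -> //.
have Lp : L (if side (st_w R a) == side w0 then st_w R a else st_w R b) = L w0.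
  by rewrite Lw0; case: ifP; rewrite Lw.
case/orP => /andP[/eqP -> /eqP ->]; rewrite Lp //.
exact/nesym.
Qed.

(* [cl t] maps the three kinds of pairs of [hex t] to their classes mod 3.       *)
Definition vertex (H : finType) (hex : tri -> H) (cl : tri -> tri -> tri) (v : cell)
  : hv H := (hex v.1.1, hex_vertex (cl v.1.1 v.1.2) v.2).

(** The interface between [K] and the model: the ear of [K], with its white edges, is a copy of the
    cells with matching [m]. *)
Record coords (H : finType) (K : pseudohex H) (hex : tri -> H)
  (cl : tri -> tri -> tri) (m : matching) : Prop := Coords {
  coords_hex : injective hex;
  coords_cl : forall t, injective (cl t);
  coords_valid : valid m;
  coords_derived : forall v, derived K (vertex hex cl v) = (v.1.2 == t0);
  coords_wh : forall v w, wmate m v = Some w ->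
    wh K (vertex hex cl v) = vertex hex cl w;
  coords_out : forall v, wmate m v = None ->
    forall t, (wh K (vertex hex cl v)).1 <> hex t
}.

(** * The ear of a pseudohex seen through coordinates *)

Section Ear.
Variables (H : finType) (K : pseudohex H).
Hypotheses (KP : is_pseudohex K) (noend : ~~ has_end K).
Variables (hex : tri -> H) (cl : tri -> tri -> tri) (m : matching).
Hypothesis KC : coords K hex cl m.

Let A := [set hex t0; hex t1; hex t2].
Let hexI := coords_hex KC.
Let clI t : injective (cl t) := @coords_cl _ _ _ _ _ KC t.
Local Notation vtx := (vertex hex cl).

Lemma hex_in t : hex t \in A.
Proof. by case: t => [[]|]; rewrite !inE eqxx ?orbT. Qed.

Lemma hexP h : h \in A -> exists t, h = hex t.
Proof. by rewrite !inE -orbA => /or3P[] /eqP ->; eexists. Qed.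

Lemma vertex_inj : injective vtx.
Proof.
move=> [[t k] s] [[t' k'] s'] /= [/hexI tt]; move: k' s'; rewrite -{}tt => k' s' E.
have := congr1 cls E; rewrite !cls_hex_vertex => /clI ->.
by have := congr1 (fun i : 'I_6 => odd i) E; rewrite !odd_hex_vertex => ->.
Qed.

Lemma vertexP (x : hv H) : x.1 \in A -> exists v, x = vtx v.
Proof.
case: x => h i /= /hexP[t ->].
exists (t, invF (@clI t) (cls i), odd i).
by rewrite /vertex /= f_invF hex_vertexK.
Qed.

Lemma bar_vertex v : bar (vtx v) = vtx (v.1, ~~ v.2).
Proof. by rewrite barE /vertex /= cls_hex_vertex odd_hex_vertex. Qed.

Lemma whA v : ((wh K (vtx v)).1 \in A) = (wmate m v != None).
Proof.
case E: (wmate m v) => [w|]; first by rewrite (coords_wh KC E) hex_in.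
by apply/negP => /hexP[t]; apply: (coords_out KC E).
Qed.

Lemma dcellsP v : v.1.2 = t0 -> v \in dcells.
Proof. by case: v => [[t k] s] /= ->; apply: mem_dcells. Qed.

Lemma no_edgesP e :
  reflect (exists2 v, v.1.2 = t0 & e = wedge K (vtx v)) (e \in no_edges K A).
Proof.
rewrite inE; apply: (iffP existsP) => [[x]|[v vD ->]].
  case/andP => /andP[/eqP -> dx] /vertexP[v E]; exists v; last by rewrite E.
  by apply/eqP; rewrite -(coords_derived KC) -E.
by exists (vtx v); rewrite eqxx (coords_derived KC) vD hex_in.
Qed.

Lemma same_wedgeP v w : same_wedge m v w -> wedge K (vtx v) = wedge K (vtx w).
Proof.
case/orP => [/eqP -> //|/eqP E].
by rewrite -(coords_wh KC E) wedge_wh.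
Qed.

(** The map [cl t] may reverse the cyclic order of the pairs, which exchanges the two perfect
    matchings of the hexagon; the bit [o t] corrects for this. *)
Lemma choice_of_matchings (sg : tri -> bool) : exists b : H -> bool,
  forall v y, Nadj A b (vtx v) y = (y == vtx (nmate sg v)).
Proof.
have /fin_all_exists[o oP] t := inj_tri_rot (@clI t).
(* Hexagons off the ear get the arbitrary value [false]; [Nadj] ignores them. *)
pose b h := if [pick t | hex t == h] is Some t then sg t (+) o t else false.
have bE t : b (hex t) = sg t (+) o t.
  rewrite /b; case: pickP => [t' /eqP/hexI -> //|/(_ t)]; by rewrite eqxx.
exists b => [[[t k] s]] y.
by rewrite /vertex /= Nadj_hex_vertex ?hex_in // bE oP addbA.
Qed.

Definition cell_of (x : hv H) : option cell := [pick v | vtx v == x].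

Lemma cell_of_vertex v : cell_of (vtx v) = Some v.
Proof.
rewrite /cell_of; case: pickP => [w /eqP/vertex_inj -> //|/(_ v)].
by rewrite eqxx.
Qed.

Lemma cell_of_None x : x.1 \notin A -> cell_of x = None.
Proof.
by move=> xA; rewrite /cell_of; case: pickP => // v /eqP E; rewrite -E hex_in in xA.
Qed.

(** Extends [lab] to all vertices: the outer end of a white edge leaving the ear inherits the label
    of the inner end, and every white edge missing the ear gets a label of its own. *)
Definition label (lab : cell -> nat) (x : hv H) : nat + {set hv H} :=
  if cell_of x is Some v then inl (lab v)
  else if cell_of (wh K x) is Some v then inl (lab v)
  else inr (wedge K x).

Lemma label_vertex lab v : label lab (vtx v) = inl (lab v).
Proof. by rewrite /label cell_of_vertex. Qed.

(** * Contracted paths for a fixed choice of matchings *)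

Section Choice.
Variables (sg : tri -> bool) (b : H -> bool) (lab : cell -> nat).
Hypothesis bP : forall v y, Nadj A b (vtx v) y = (y == vtx (nmate sg v)).
Hypothesis labP : compatible m sg lab.

Lemma lab_nmate v : lab (nmate sg v) = lab v.
Proof. by have /allP/(_ v (mem_cells v))/andP[/eqP] := labP. Qed.

Lemma lab_wmate v w : wmate m v = Some w -> lab w = lab v.
Proof.
by have /allP/(_ v (mem_cells v))/andP[_] := labP => + E; rewrite E => /eqP.
Qed.

Lemma label_wh x : label lab (wh K x) = label lab x.
Proof.
have key v : label lab (wh K (vtx v)) = inl (lab v).
  case E: (wmate m v) => [w|].
    by rewrite (coords_wh KC E) label_vertex (lab_wmate E).
  by rewrite /label cell_of_None ?whA ?E // whK // cell_of_vertex.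
have [/vertexP[v ->]|xA] := boolP (x.1 \in A); first by rewrite key label_vertex.
have [/vertexP[v E]|wA] := boolP ((wh K x).1 \in A).
  by rewrite -[x in RHS](whK KP) E key label_vertex.
by rewrite /label !cell_of_None ?whK // wedge_wh.
Qed.

Lemma label_Nadj x y : Nadj A b x y -> label lab x = label lab y.
Proof.
move=> xy; have /andP[/vertexP[v xE] _] := xy; move: xy; rewrite {}xE bP => /eqP ->.
by rewrite !label_vertex lab_nmate.
Qed.

Lemma label_connect x y : connect (cadj K A b) x y -> label lab x = label lab y.
Proof.
apply: connect_invariant => u v /orP[/label_Nadj //|/andP[/eqP -> _]].
by rewrite label_wh.
Qed.

Lemma comp_derivedP r e : e \in comp_derived K A b r ->
  exists v, [/\ v.1.2 = t0, e = wedge K (vtx v) & label lab r = inl (lab v)].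
Proof.
rewrite inE => /existsP[x /andP[/andP[/andP[/eqP -> xA] dx] /label_connect ->]].
have [v [dv -> ->]] : exists v, [/\ derived K (vtx v), wedge K x = wedge K (vtx v)
    & label lab x = label lab (vtx v)].
  case/orP: xA; rewrite inE => /vertexP[v E]; exists v; rewrite -E //.
  by rewrite wedge_wh // label_wh /derived real_wh.
exists v; split=> //; last by rewrite label_vertex.
by apply/eqP; rewrite -(coords_derived KC).
Qed.

End Choice.

(** * From patterns of derived edges to obstacles, dangers and reductions *)

Lemma card_ear v : #|wedge K (vtx v) :&: Vset A| = (wmate m v != None).+1.
Proof. by rewrite card_wedgeI // ![_ \in Vset _]inE whA hex_in. Qed.

Lemma in_leaves v : (vtx v \in Vset [set hex t0; hex t1]) = (v.1.1 != t2).
Proof. by rewrite !inE !(inj_eq hexI); case: v => [[[[]|] ?] ?]. Qed.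

Lemma in_centre v : (vtx v \in Vset [set hex t2]) = (v.1.1 == t2).
Proof. by rewrite !inE (inj_eq hexI). Qed.

Lemma wh_in (B : {set H}) v : B \subset A ->
  (wh K (vtx v) \in Vset B) = if wmate m v is Some w then vtx w \in Vset B else false.
Proof.
move=> BA; case E: (wmate m v) => [w|]; first by rewrite (coords_wh KC E).
rewrite inE; apply: contraTF (introT eqP E) => /(subsetP BA).
by rewrite whA.
Qed.

Lemma leaves_sub : [set hex t0; hex t1] \subset A.
Proof. exact: subsetUl. Qed.

Lemma centre_sub : [set hex t2] \subset A.
Proof. exact: subsetUr. Qed.

Lemma wedge_vertex_inj v w :
  wedge K (vtx v) = wedge K (vtx w) -> same_wedge m w v.
Proof.
case/wedge_inj => // [/vertex_inj ->|E]; first by rewrite /same_wedge eqxx.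
have: (wh K (vtx w)).1 \in A by rewrite -E hex_in.
rewrite whA; case F: (wmate m w) => [u|] // _.
by move: E; rewrite (coords_wh KC F) /same_wedge F => /vertex_inj ->; rewrite eqxx orbT.
Qed.

Lemma obstacle_of_pattern :
  obstacle_pattern m -> P_obstacle K (hex t0) (hex t1) (hex t2).
Proof.
move=> /allP mN e /no_edgesP[v vD ->].
by rewrite card_ear (eqP (mN v (dcellsP vD))).
Qed.

Lemma danger_of_shape p q s : p != q -> p != t2 -> q != t2 ->
  danger_shape m p q s -> P_danger K (hex t0) (hex t1) (hex t2).
Proof.
move=> pq pz qz /and4P[/eqP pM /eqP pM' /eqP qM /eqP zM].
pose E v := wedge K (vtx v).
have E1 : E (p, t0, s) = E (q, t0, ~~ s).
  by apply: same_wedgeP; rewrite /same_wedge pM eqxx orbT.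
have E2 : E (p, t0, ~~ s) = E (t2, t0, s).
  by apply: same_wedgeP; rewrite /same_wedge pM' eqxx orbT.
exists (E (p, t0, s)), (E (p, t0, ~~ s)), (E (q, t0, s)), (E (t2, t0, ~~ s)).
split; last split; last split; last split; last split; last split.
- rewrite /= !inE !negb_or.
  have ne v w : v != w -> wmate m w != Some v -> E v != E w.
    move=> vw mwv; apply/eqP => /wedge_vertex_inj.
    by rewrite /same_wedge eq_sym (negPf vw) (negPf mwv).
  have ss : s != ~~ s by case: (s).
  have ne1 v w : wmate m w = Some v -> forall u, (wmate m w != Some u) = (v != u).
    by move=> -> u; rewrite (inj_eq Some_inj).
  by rewrite !ne ?(ne1 _ _ pM') ?qM ?zM ?xpair_eqE /= ?(negPf pq) ?(negPf pz) ?(negPf qz)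
    ?(eq_sym t2) ?(negPf pz) ?(negPf ss) ?andbF //.
- apply/setP => e; apply/no_edgesP/idP => [[[[h k] s'] /= -> ->]|].
    have hpq : [\/ h = p, h = q | h = t2].
      move: pq pz qz {pM pM' qM E1 E2}; case: p q h => [[]|] [[]|] [[]|] // _ _ _;
      by [constructor 1 | constructor 2 | constructor 3].
    have ss : s' = s \/ s' = ~~ s.
      by case: (s) (s') => [] []; [left|right|right|left].
    by case: hpq ss => -> [] ->; rewrite -/(E _) -?E1 -?E2 !inE eqxx ?orbT //.
  rewrite !inE -!orbA => /or4P[] /eqP ->;
    by [exists (p, t0, s) | exists (p, t0, ~~ s) | exists (q, t0, s)
       | exists (t2, t0, ~~ s)].
- apply/subsetP => y /set2P[] ->; first by rewrite in_leaves.
  by rewrite wh_in ?leaves_sub // pM in_leaves.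
- by rewrite card_wedgeI // wh_in ?leaves_sub // pM' !in_leaves pz.
- by rewrite card_wedgeI // wh_in ?centre_sub // pM' !in_centre (negPf pz).
- by rewrite card_ear qM.
- by rewrite card_ear zM.
Qed.

Lemma danger_of_pattern :
  danger_pattern m -> P_danger K (hex t0) (hex t1) (hex t2).
Proof. by case/or4P; apply: danger_of_shape. Qed.

(** Three of the four no-edges suffice for [danger_patternP]: the one inside the leaves, the one
    between leaves and centre, and one that leaves the ear. *)
Lemma pattern_of_danger :
  P_danger K (hex t0) (hex t1) (hex t2) -> danger_pattern m.
Proof.
case=> e1 [e2 [e3 [e4 [_ [eE [e1S [e2xy [e2z [e3A _]]]]]]]]].
have mem e : e \in [set e1; e2; e3; e4] -> exists2 v, v.1.2 = t0 & e = wedge K (vtx v).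
  by rewrite -eE => /no_edgesP.
apply: (implyP (danger_patternP m)); apply/and4P; split; first exact: coords_valid KC.
- have [|v vD E] := mem e1; first by rewrite !inE eqxx.
  apply/hasP; exists v; first exact: dcellsP.
  rewrite /inner_xy vD eqxx /= -in_leaves.
  move/subsetP: e1S; rewrite E => sub; rewrite sub ?inE ?eqxx //=.
  move: (sub (wh K (vtx v))); rewrite wh_in ?leaves_sub //.
  by case: (wmate m v) => [w|]; rewrite ?in_leaves => -> //; rewrite !inE eqxx orbT.
- have [|v vD E] := mem e2; first by rewrite !inE eqxx orbT.
  move: e2xy e2z; rewrite E !card_wedgeI // !wh_in ?leaves_sub ?centre_sub //.
  rewrite in_leaves in_centre; case F: (wmate m v) => [w|]; last by case: eqP.
  rewrite in_centre => _ vwz.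
  have [vz|wz] : v.1.1 = t2 \/ w.1.1 = t2.
    by move: vwz; case: eqP => [|_]; [left|case: eqP => // wz _; right].
    by apply/hasP; exists v; [exact: dcellsP|rewrite vz F].
  apply/hasP; exists w; last by rewrite wz /= -whA -(coords_wh KC F) whK // hex_in.
    apply: dcellsP; apply/eqP; rewrite -(coords_derived KC) -(coords_wh KC F).
    by rewrite /derived real_wh // -/(derived _ _) (coords_derived KC) vD.
- have [|v vD E] := mem e3; first by rewrite !inE eqxx orbT.
  apply/hasP; exists v; first exact: dcellsP.
  by move: e3A; rewrite E card_ear; case: eqP.
Qed.

Lemma safely_reducible_of_pattern :
  ~~ obstacle_pattern m -> ~~ danger_pattern m -> safely_reducible K A.
Proof.
move=> nO nD; have /implyP := safe_choice_exists m.
rewrite (coords_valid KC) nO nD => /(_ isT)/hasP[c _].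
set sg := selector c => /andP[labP /allP safe].
have [b bP] := choice_of_matchings sg; exists b => r.
apply/card_le1_eqP => e1 e2 /(comp_derivedP bP labP)[v [vD -> rv]].
move=> /(comp_derivedP bP labP)[w [wD -> rw]].
have [vw] : inl (table m sg v) = inl (table m sg w) :> nat + {set hv H}.
  by rewrite -rv -rw.
apply/esym/same_wedgeP; have /allP/(_ w (dcellsP wD)) := safe v (dcellsP vD).
by rewrite vw eqxx.
Qed.

Lemma label_cases lab x : (exists2 v, x \in wedge K (vtx v) &
  label lab x = inl (lab v)) \/ label lab x = inr (wedge K x).
Proof.
rewrite /label; case E: (cell_of x) => [v|].
  left; exists v => //; move: E; rewrite /cell_of; case: pickP => // u /eqP <- [->].
  by rewrite !inE eqxx.
case E': (cell_of (wh K x)) => [v|]; last by right.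
left; exists v => //; move: E'; rewrite /cell_of; case: pickP => // u /eqP ux [<-].
by rewrite ux !inE whK // eqxx orbT.
Qed.

Lemma mem_wedge2 x y v : x \in wedge K v -> y \in wedge K v -> x = y \/ y = wh K x.
Proof.
by move=> /set2P[] -> /set2P[] ->; [left|right|right; rewrite whK|left].
Qed.

(** In a danger pattern e and g are the only edges of their kinds ([danger_unique]), so the pair
    that [danger_choice] allows on a common path is this one. The labels then serve as the invariant
    of [no_end_created]. *)
Lemma danger_reduction e g :
  danger_pattern m ->
  e \in no_edges K A -> e \subset Vset [set hex t0; hex t1] ->
  g \in no_edges K A -> #|g :&: Vset A| = 1 -> g :&: Vset [set hex t2] != set0 ->
  ~ red_connected K e g ->
  exists b : H -> bool,
    [/\ ~~ creates_end K
          (flatten [seq Nedges h (b h) | h <- [:: hex t0; hex t1; hex t2]]),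
        forall r, #|comp_derived K A b r| <= 1 \/ comp_derived K A b r = [set e; g] &
        exists r, comp_derived K A b r = [set e; g]].
Proof.
move=> mD eA exy gA gout gz nred.
have [ve [veD eE] veI] : exists2 v, v.1.2 = t0 /\ e = wedge K (vtx v) & inner_xy m v.
  have /no_edgesP[v vD E] := eA; exists v => //.
  rewrite /inner_xy vD eqxx /= -in_leaves.
  move/subsetP: exy; rewrite E => sub; rewrite sub ?inE ?eqxx //=.
  move: (sub (wh K (vtx v))); rewrite wh_in ?leaves_sub //.
  by case: (wmate m v) => [w|]; rewrite ?in_leaves => -> //; rewrite !inE eqxx orbT.
have [vg [vgD gE] vgO] : exists2 v, v.1.2 = t0 /\ g = wedge K (vtx v) & outer_z m v.
  have /no_edgesP[v vD E] := gA; exists v => //.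
  have vM : wmate m v = None by move: gout; rewrite E card_ear; case: eqP.
  rewrite /outer_z vD vM !eqxx andbT /= -in_centre.
  have /set0Pn[y] := gz; rewrite E inE => /andP[/set2P[] -> //].
  by rewrite wh_in ?centre_sub // vM.
have uniq_eg v w : v.1.2 = t0 -> w.1.2 = t0 ->
    inner_xy m v && inner_xy m w || outer_z m v && outer_z m w ->
    wedge K (vtx v) = wedge K (vtx w).
  move=> vD wD vw; apply: same_wedgeP; have /implyP := danger_unique m.
  rewrite (coords_valid KC) mD => /(_ isT)/allP/(_ v (dcellsP vD)).
  by move=> /allP/(_ w (dcellsP wD)); rewrite vw.
have inner_e v : v.1.2 = t0 -> inner_xy m v -> wedge K (vtx v) = e.
  by move=> vD vI; rewrite eE; apply: uniq_eg => //; rewrite vI veI.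
have outer_g v : v.1.2 = t0 -> outer_z m v -> wedge K (vtx v) = g.
  by move=> vD vO; rewrite gE; apply: uniq_eg => //; rewrite vO vgO orbT.
have e_neq_g : e != g.
  apply/eqP; rewrite eE gE => /wedge_vertex_inj.
  move: veI vgO => /and3P[_ vez _] /and3P[_ /eqP vgz /eqP vgM].
  by rewrite /same_wedge vgM orbF => /eqP E; rewrite -E vgz in vez.
have /implyP := danger_choice_exists m.
rewrite (coords_valid KC) mD => /(_ isT)/hasP[c _].
set sg := selector c; set lab := table m sg.
case/and4P=> labP /allP good /allP labbar /hasP[v0 _ chain].
have [b bP] := choice_of_matchings sg; exists b.
have same_lab v w : v.1.2 = t0 -> w.1.2 = t0 -> lab v = lab w ->
    [\/ wedge K (vtx v) = wedge K (vtx w),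
        wedge K (vtx v) = e /\ wedge K (vtx w) = g |
        wedge K (vtx v) = g /\ wedge K (vtx w) = e].
  move=> vD wD vw; have /allP/(_ w (dcellsP wD)) := good v (dcellsP vD).
  rewrite vw eqxx => /or3P[/same_wedgeP|/andP[vI wO]|/andP[wI vO]].
  - by constructor 1.
  - by constructor 2; rewrite (inner_e v) // (outer_g w).
  - by constructor 3; rewrite (inner_e w) // (outer_g v).
have comp r : #|comp_derived K A b r| <= 1 \/ comp_derived K A b r = [set e; g].
  case: leqP => [|/card_gt1P[e1 [e2 [e1r e2r e12]]]]; [by left|right].
  have cmp e' e'' : e' \in comp_derived K A b r -> e'' \in comp_derived K A b r ->
      [\/ e' = e'', e' = e /\ e'' = g | e' = g /\ e'' = e].
    move=> /(comp_derivedP bP labP)[v [vD -> rv]].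
    move=> /(comp_derivedP bP labP)[w [wD -> rw]].
    by apply: same_lab => //; move: rw; rewrite rv => -[].
  have [er gr] : e \in comp_derived K A b r /\ g \in comp_derived K A b r.
    case: (cmp e1 e2 e1r e2r) => [E|[<- <-] //|[<- <-] //].
    by rewrite E eqxx in e12.
  apply/setP => e'; rewrite in_set2; apply/idP/orP => [e'r|[] /eqP -> //].
  by case: (cmp e' e e'r er) => [->|[-> _]|[-> _]]; [left|left|right].
split=> //.
- apply: (@no_end_created _ _ _ (label lab)).
  + exact: red_bar.
  + exact: (label_wh labP).
  + move=> x y xy.
    (* At a real edge the only red edges are antipodal, and [labbar] separates antipodal
       vertices. *)
    have real_case u w v : u \in wedge K (vtx v) -> v.1.2 != t0 -> red K u w ->
        label lab u <> label lab w.
      move=> uv vK uw.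
      have vR : real K (vtx v) by rewrite -[real _ _]negbK -/(derived _ _)
        (coords_derived KC).
      have uR : real K u by case/set2P: uv => ->; rewrite ?real_wh.
      have lv : label lab (bar (vtx v)) <> label lab (vtx v).
        rewrite bar_vertex !label_vertex => -[].
        by apply/eqP; apply: (implyP (labbar v (mem_cells v))).
      rewrite (real_red uR uw); case/set2P: uv => ->; first exact: nesym.
      by rewrite -real_wh_bar // !(label_wh labP); apply: nesym.
    (* An [inl] label never equals an [inr] one; two equal [inr] labels put the red edge on a single
       white edge, making it a loop or an end. *)
    have [[v xv lx]|lx] := label_cases lab x; have [[w yw ly]|ly] := label_cases lab y;
      rewrite ?lx ?ly //; last first.
      move=> [] /wedge_inj[] // E; first by have := red_neq KP xy; rewrite E eqxx.
      by rewrite E redC // red_whF in xy.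
    have [vD|vD] := eqVneq v.1.2 t0; last by rewrite -lx -ly; apply: real_case vD xy.
    have [wD|wD] := eqVneq w.1.2 t0; last first.
      by rewrite -lx -ly; apply: nesym; apply: real_case wD _; rewrite // redC.
    case=> /same_lab - /(_ vD wD)[vw|[vwe wwg]|[vwg wwe]].
    * rewrite vw in xv; case: (mem_wedge2 xv yw) => E.
        by have := red_neq KP xy; rewrite E eqxx.
      by rewrite E red_whF in xy.
    * by apply: nred; exists x, y; rewrite -vwe -wwg; split=> //; split; [left|right].
    * by apply: nred; exists x, y; rewrite -vwg -wwe; split=> //; split; [right|left].
  + move=> ab /flatten_mapP[h hA abN].
    have hA' : h \in A.
      by move: hA; rewrite !inE => /or3P[] /eqP ->; rewrite eqxx ?orbT.
    have abh : ab.1.1 = h.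
      by move: abN; rewrite /Nedges; case: (b h); rewrite !inE => /or3P[] /eqP ->.
    apply: (label_Nadj bP labP).
    by rewrite /Nadj abh hA' -surjective_pairing abN.
- have /andP[v0I] := chain; case E: (wmate m (nmate sg v0)) => [w|] // wO.
  have v0D : v0.1.2 = t0 by case/and3P: v0I => /eqP.
  have wD : (nmate sg w).1.2 = t0 by case/and3P: wO => /eqP.
  (* The walk in [chain] puts both e and g on this contracted path, so the bound 1 would force e =
     g. *)
  exists (vtx v0); case: (comp (vtx v0)) => // /card_le1_eqP le1.
  have eI : e \in comp_derived K A b (vtx v0).
    rewrite inE; apply/existsP; exists (vtx v0).
    rewrite inner_e // eqxx (coords_derived KC) v0D connect0.
    by rewrite [_ \in Vset _]inE hex_in.
  have gI : g \in comp_derived K A b (vtx v0).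
    rewrite inE; apply/existsP; exists (vtx (nmate sg w)).
    rewrite outer_g // eqxx (coords_derived KC) wD [_ \in Vset _]inE hex_in /=.
    apply: (@connect_trans _ _ (vtx (nmate sg v0))).
      by apply: connect1; rewrite /cadj bP eqxx.
    apply: (@connect_trans _ _ (vtx w)).
      apply: connect1; apply/orP; right; rewrite (coords_wh KC E) eqxx.
      by rewrite [_ \in Vset _]inE hex_in.
    by apply: connect1; rewrite /cadj bP eqxx.
  by have := le1 _ _ eI gI => E'; rewrite E' eqxx in e_neq_g.
Qed.

End Ear.

(** * Existence of coordinates for an ear arising from P-addition *)

(** The derived pair takes the class left over by the classes [a] and [b] of the two real pairs. *)
Definition kind_class (a b : tri) (k : tri) : tri :=
  match k with
  | Some false => a | Some true => b
  | None => if next3 a == b then prev3 a else next3 a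
  end.

Lemma kind_class_inj a b : a <> b -> injective (kind_class a b).
Proof. by case: a b => [[]|] [[]|] // _ [[]|] [[]|]. Qed.

Lemma wmate_derived m t s :
  wmate m (t, t0, s) = omap (fun t' => (t', t0, ~~ s)) (mate m t s).
Proof. by case: t => [[]|]. Qed.

(** The vertices [x0], [x1], [x2], [x3] represent the four edges of the hexagon graph at the ear.
    They use two pairs of each hexagon, and the last hypothesis makes the third pair derived; the
    matching is then read off from [wh K]. *)
Lemma coords_exist (H : finType) (K : pseudohex H) (hex : tri -> H)
    (x0 x1 x2 x3 : hv H) :
  is_pseudohex K -> ~~ has_end K -> injective hex ->
  [/\ real K x0, real K x1, real K x2 & real K x3] ->
  x0.1 = hex t0 -> x1.1 = hex t1 -> x2.1 = hex t0 -> x3.1 = hex t1 ->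
  (wh K x0).1 = hex t2 -> (wh K x1).1 = hex t2 ->
  (forall t, (wh K x2).1 <> hex t) -> (forall t, (wh K x3).1 <> hex t) ->
  (forall v t, real K v -> v.1 = hex t -> cls v.2 \in
     [:: cls (if t is Some e then if e then wh K x0 else x1 else x0).2;
         cls (if t is Some e then if e then wh K x1 else x3 else x2).2]) ->
  exists cl m, coords K hex cl m.
Proof.
move=> KP noend hexI [r0 r1 r2 r3] x0h x1h x2h x3h w0h w1h w2h w3h only.
pose ra (t : tri) := if t is Some e then if e then wh K x0 else x1 else x0.
pose rb (t : tri) := if t is Some e then if e then wh K x1 else x3 else x2.
have raR t : real K (ra t) /\ (ra t).1 = hex t.
  by case: t => [[]|]; split => //=; rewrite ?real_wh.
have rbR t : real K (rb t) /\ (rb t).1 = hex t.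
  by case: t => [[]|]; split => //=; rewrite ?real_wh.
pose cl t := kind_class (cls (ra t).2) (cls (rb t).2).
have clI t : injective (cl t).
  (* If the two real pairs of a hexagon coincided, their white edges would lead to the same
     hexagon. *)
  apply: kind_class_inj => E; have [aR ah] := raR t; have [bR bh] := rbR t.
  have [|_ + _] := real_same_pair aR _ E; first by rewrite ah bh.
  case: t {E aR ah bR bh} => [[]|] /=; rewrite ?whK //.
  - by rewrite x0h x1h => /hexI.
  - by rewrite w1h => /w3h.
  - by rewrite w0h => /w2h.
pose vtx := vertex hex cl.
have vtxP t k x : x.1 = hex t -> cls x.2 = cl t k -> x = vtx (t, k, odd x.2).
  move=> xh xc; apply: vertex_eq => //=; first by rewrite cls_hex_vertex.
  by rewrite odd_hex_vertex.
have vtx_real v : real K (vtx v) = (v.1.2 != t0).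
  case: v => [[t k] s] /=; case: k => [e|] /=.
    have [aR ah] := raR t; have [bR bh] := rbR t.
    have [] // := @real_same_pair _ K (if e then rb t else ra t) (vtx (t, Some e, s)).
    - by case: e.
    - by case: e; rewrite /= ?ah ?bh.
    - by case: e; rewrite /= cls_hex_vertex.
  apply/negP => vR; have := only _ t vR erefl.
  rewrite /= cls_hex_vertex -/(ra t) -/(rb t) !inE.
  by case/orP => /eqP; [move/(@clI t None t1)|move/(@clI t None t2)].
(* The mate of a derived end is derived and on the other side, so inside the ear its hexagon
   determines it. *)
have whD t s t' : (wh K (vtx (t, t0, s))).1 = hex t' ->
    wh K (vtx (t, t0, s)) = vtx (t', t0, ~~ s).
  move=> h; set x := wh K _ in h *.
  have xE := vtxP t' _ _ h (esym (f_invF (@clI t') (cls x.2))).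
  have xs : odd x.2 = ~~ s by rewrite side_wh //= odd_hex_vertex.
  move: xE; rewrite xs; set k := invF _ _ => xE.
  have : real K x = false by rewrite real_wh // vtx_real.
  by rewrite xE vtx_real => /negbFE/eqP /= ->.
pose me t := [pick t' | (wh K (vtx (t, t0, false))).1 == hex t'].
have meP t t' : me t = Some t' <-> (wh K (vtx (t, t0, false))).1 = hex t'.
  rewrite /me; case: pickP => [u /eqP uE|none]; split=> //.
  - by case=> <-.
  - by rewrite uE => /hexI ->.
  - by move/eqP; rewrite none.
pose m : matching := (me t0, me t1, me t2).
have mE t : mate_even m t = me t by case: t => [[]|].
have mV : valid m.
  apply: validP => [t|t t' u]; rewrite !mE.
    move=> /meP/whD E; have := red_bar KP (vtx (t, t0, false)).
    have -> : bar (vtx (t, t0, false)) = vtx (t, t0, true).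
      by rewrite barE /= cls_hex_vertex odd_hex_vertex.
    by rewrite -E red_whF.
  move=> /meP/whD E /meP/whD; rewrite -E => /(can_inj (whK KP))/(congr1 fst)/hexI.
  exact: esym.
have modd t t' : mate m t true = Some t' <-> (wh K (vtx (t, t0, true))).1 = hex t'.
  have /implyP/(_ mV)/eqP E := mate_odd m t t'.
  split=> [/eqP|/whD E'].
    by rewrite E mE => /eqP/meP/whD <-; rewrite whK.
  by apply/eqP; rewrite E mE; apply/eqP/meP; rewrite -E' whK.
have mateP t s u : mate m t s = Some u <-> (wh K (vtx (t, t0, s))).1 = hex u.
  by case: s; [apply: modd|rewrite /mate mE; apply: meP].
have wh1 x t j u k s : real K x -> x.1 = hex t -> (wh K x).1 = hex u ->
    cls x.2 = cl t j -> cls (wh K x).2 = cl u k ->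
    wh K (vtx (t, j, s)) = vtx (u, k, ~~ s).
  move=> xR xh wxh xc wxc.
  have [||_ wh_h wh_c] := @real_same_pair _ K x (vtx (t, j, s)) xR.
  - exact: xh.
  - by rewrite /= cls_hex_vertex.
  have -> : ~~ s = odd (wh K (vtx (t, j, s))).2 by rewrite side_wh //= odd_hex_vertex.
  by apply: vtxP; rewrite ?wh_h ?wh_c.
have wh2 x t s : real K x -> x.1 = hex t -> cls x.2 = cl t t2 ->
    (wh K (vtx (t, t2, s))).1 = (wh K x).1.
  move=> xR xh xc; have [||_ -> //] := @real_same_pair _ K x (vtx (t, t2, s)) xR.
  - exact: xh.
  - by rewrite /= cls_hex_vertex.
exists cl, m; split; [exact: hexI|exact: clI|exact: mV| | | ].
- by move=> v; rewrite /derived vtx_real negbK.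
- move=> v w; rewrite -/vtx; case: v => [[t [[]|]] s].
  + case: t => [[]|] //= [<-].
    by apply: (wh1 (wh K x1)) => //=; rewrite ?real_wh ?whK.
  + case: t => [[]|] //= [<-].
    * by apply: (wh1 (wh K x0)) => //=; rewrite ?real_wh ?whK.
    * exact: (wh1 x1).
    * exact: (wh1 x0).
  + by rewrite wmate_derived; case E: (mate m t s) => [u|] // [<-]; apply/whD/mateP.
- move=> v; rewrite -/vtx; case: v => [[t [[]|]] s].
  + case: t => [[]|] // _ u.
    * have -> : (wh K (vtx (t1, t2, s))).1 = (wh K x3).1 by apply: wh2.
      exact: w3h.
    * have -> : (wh K (vtx (t0, t2, s))).1 = (wh K x2).1 by apply: wh2.
      exact: w2h.
  + by case: t => [[]|].
  + rewrite wmate_derived; case E: (mate m t s) => [u|] // _ u /mateP.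
    by rewrite E.
Qed.

Lemma set2_eq_snd (T : finType) (a b c : T) : b != a -> [set a; c] = [set a; b] -> c = b.
Proof.
move=> ba E; have: b \in [set a; c] by rewrite E !inE eqxx orbT.
by rewrite !inE (negPf ba) => /eqP.
Qed.

(** The old edges of the extended graph avoid the three new vertices, so under the isomorphism every
    edge of [GK K] at the ear is the image of one of the four new edges. *)
Lemma ear_coords (H H' : finType) (K : pseudohex H) (K' : pseudohex H')
    (u v : mV (GK K')) (fV : mV (add_bold_3ear u v) -> mV (GK K))
    (fE : mE (add_bold_3ear u v) -> mE (GK K)) :
  is_pseudohex K -> ~~ has_end K -> mgraph_iso fV fE ->
  exists cl m, coords K (fun t : tri => match t with
    | None => fV (inr ear_x) | Some false => fV (inr ear_y)
    | Some true => fV (inr ear_z) end) cl m.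
Proof.
move=> KP noend [/bij_inj fVI [[gE gEK fEK] fEnds]]; set hex := fun t : tri => _.
have [xy xz yz] : [/\ ear_x != ear_y, ear_x != ear_z & ear_y != ear_z].
  by split; apply/eqP => /(congr1 val); rewrite /= !inordK.
have hexI : injective hex.
  by move=> [[]|] [[]|] // /fVI[] E; move: xy xz yz; rewrite E eqxx.
have out t w : fV (inl w) <> hex t by case: t => [[]|] /fVI.
have repr (E : GE K) p q : GK_ends E = [set fV p; fV q] -> p != q ->
    exists x, [/\ real K x, val E = [set wedge K x; wedge K (bar x)],
                  x.1 = fV p & (wh K x).1 = fV q].
  move=> Eends pq; have [|x [xR xE xp]] := @GE_repr _ _ KP E (fV p).
    by rewrite Eends !inE eqxx.
  rewrite Eends => /esym ends; exists x; split=> //; apply: set2_eq_snd ends.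
  by rewrite (inj_eq fVI) eq_sym.
have ends k p q : mends (inr k : mE (add_bold_3ear u v)) = [set p; q] ->
    GK_ends (fE (inr k)) = [set fV p; fV q].
  by move=> E; rewrite [LHS](fEnds (inr k)) E imsetU1 imset_set1.
have [x0 [x0R x0E x0h x0w]] :=
  repr _ _ _ (ends (@Ordinal 4 0 isT) (inr ear_x) (inr ear_z) erefl) xz.
have [x1 [x1R x1E x1h x1w]] :=
  repr _ _ _ (ends (@Ordinal 4 1 isT) (inr ear_y) (inr ear_z) (setUC _ _)) yz.
have [x2 [x2R x2E x2h x2w]] :=
  repr _ _ _ (ends (@Ordinal 4 2 isT) (inr ear_x) (inl u) erefl) isT.
have [x3 [x3R x3E x3h x3w]] :=
  repr _ _ _ (ends (@Ordinal 4 3 isT) (inr ear_y) (inl v) erefl) isT.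
apply: (@coords_exist _ K hex x0 x1 x2 x3) => //.
- by move=> t; rewrite x2w; apply: out.
- by move=> t; rewrite x3w; apply: out.
move=> w t wR wt.
have EP : isGE K [set wedge K w; wedge K (bar w)].
  by apply/existsP; exists w; rewrite wR eqxx.
pose E : GE K := exist (fun E => isGE K E) _ EP.
have : hex t \in GK_ends E.
  by rewrite inE; apply/existsP; exists w; rewrite !inE eqxx /= wt.
have wE : wedge K w \in val E by rewrite !inE eqxx.
(* Replaces [E] by the image of its preimage, which is either an old edge, missing the ear, or one
   of the four new ones. *)
rewrite -(fEK E) in wE *; case: (gE E) wE => [e _|k wE _].
  rewrite [GK_ends _](fEnds (inl e)) /=.
  have [s ->] : exists s, hex t = fV (inr s) by case: (t) => [[]|]; eexists.
  by rewrite (mem_imset _ _ fVI) => /imsetP[].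
have ktype : [\/ k = @Ordinal 4 0 isT, k = @Ordinal 4 1 isT, k = @Ordinal 4 2 isT
    | k = @Ordinal 4 3 isT].
  case: (k) => [[|[|[|[|]]]] lt] //; [constructor 1|constructor 2|constructor 3|
    constructor 4]; exact: val_inj.
have clash a : w.1 = hex a -> t = a by rewrite wt => /hexI.
case: ktype wE => ->.
- by move=> /(GE_eq x0R x0E); rewrite x0h x0w =>
    -[[/(clash t0) -> ->]|[/(clash t2) -> ->]]; rewrite !inE eqxx ?orbT.
- by move=> /(GE_eq x1R x1E); rewrite x1h x1w =>
    -[[/(clash t1) -> ->]|[/(clash t2) -> ->]]; rewrite !inE eqxx ?orbT.
- move=> /(GE_eq x2R x2E); rewrite x2h x2w => -[[/(clash t0) -> ->]|[]].
    by rewrite !inE eqxx ?orbT.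
  by rewrite wt => /esym/out.
- move=> /(GE_eq x3R x3E); rewrite x3h x3w => -[[/(clash t1) -> ->]|[]].
    by rewrite !inE eqxx ?orbT.
  by rewrite wt => /esym/out.
Qed.

Theorem mainTheorem5 (H H' : finType) (K : pseudohex H) (K' : pseudohex H')
  (u v : mV (GK K'))
  (fV : mV (add_bold_3ear u v) -> mV (GK K))
  (fE : mE (add_bold_3ear u v) -> mE (GK K)) :
  proper_pseudohex K -> proper_pseudohex K' -> P_addition fV fE ->
  let hx := fV (inr ear_x) in
  let hy := fV (inr ear_y) in
  let hz := fV (inr ear_z) in
  let A := [set hx; hy; hz] in
  (* (1) *)
  ((~ P_obstacle K hx hy hz) -> (~ P_danger K hx hy hz) ->
     safely_reducible K A) /\
  (* (2) *)
  (P_danger K hx hy hz -> ~ P_bad K hx hy hz ->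
   forall e g : {set hv H},
     e \in no_edges K A -> e \subset Vset [set hx; hy] ->
     g \in no_edges K A -> #|g :&: Vset A| = 1 -> g :&: Vset [set hz] != set0 ->
     exists (b : H -> bool) (hs : seq H) (ord : H -> seq (hv H * hv H)),
       [/\ perm_eq hs [:: hx; hy; hz],
           (forall h, perm_eq (ord h) (Nedges h (b h))),
           ~~ creates_end K (flatten (map ord hs)),
           (forall r, #|comp_derived K A b r| <= 1 \/
                      comp_derived K A b r = [set e; g]) &
           (exists r, comp_derived K A b r = [set e; g])]).
Proof.
move=> [KP [noend _]] _ [_ [_ [_ iso]]] hx hy hz A.
have [cl [m KC]] := ear_coords KP noend iso.
split=> [nobs ndan|dan nbad e g eA exy gA gout gz].
  apply: (safely_reducible_of_pattern KP KC).
    by apply/negP => /(obstacle_of_pattern KP KC).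
  by apply/negP => /(danger_of_pattern KP KC).
have nred : ~ red_connected K e g.
  by move=> eg; apply: nbad; split=> //; exists e, g.
have [b [noE comp ex]] := danger_reduction KP noend KC
  (pattern_of_danger KP KC dan) eA exy gA gout gz nred.
by exists b, [:: hx; hy; hz], (fun h => Nedges h (b h)).
Qed.
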